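(* Let $n,k,m,d$ be positive integers. (1) Let $n\ge k$, and for every $i\in[n]$ let $\mathcal{F}_i$ be a hypergraph of $d$-intervals. If $\tau\big(\bigcup_{i\in I}\mathcal{F}_i\big)\ge k$ for every $I\subseteq[n]$ with $|I|=n-k+1$, then there exists a colorful matching $\mathcal{M}$ of $(\mathcal{F}_1,\dots,\mathcal{F}_n)$ of size $|\mathcal{M}|\ge \frac{k}{d^2-d+1}$. (2) Let $n\ge (m-1)d+1$, and for every $i\in[n]$ let $\mathcal{F}_i$ be a hypergraph of separated $d$-intervals. If $\tau\big(\bigcup_{i\in I}\mathcal{F}_i\big)\ge (m-1)d+1$ for every $I\subseteq[n]$ with $|I|=n-(m-1)d$, then there exists a colorful matching $\mathcal{M}$ of $(\mathcal{F}_1,\dots,\mathcal{F}_n)$ of size $|\mathcal{M}|\ge\frac{m}{d-1}$.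
   Context: A $d$-interval is a union of $d$ closed intervals in $\mathbb{R}$. A separated $d$-interval is a $d$-interval consisting of $d$ disjoint interval components $h^1,\dots,h^d$ with $h^{i+1}\subset(i,i+1)$ for $0\le i\le d-1$. A hypergraph of (separated) $d$-intervals is a hypergraph with vertex set $\mathbb{R}$ whose edge set is a finite family of (separated) $d$-intervals. A matching is a set of pairwise disjoint edges; a cover is a set of vertices meeting every edge, and $\tau(H)$ is the minimum size of a cover of $H$. For families of edges $\mathcal{F}_1,\dots,\mathcal{F}_n$, a colorful matching is a matching $\mathcal{M}$ in $\bigcup_i\mathcal{F}_i$ with $|\mathcal{M}\cap\mathcal{F}_i|\le 1$ for every $i$.
   Formalization: Edges of a colorful matching carry colors: at most one edge is chosen as representative of each F_i, though it may also lie in other families (literal |M∩F_i|≤1 fails for F_1=F_2={two disjoint intervals}, n=k=2, d=1); part (2) assumes d≥2, since m/(d-1) is undefined for d=1. *)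

(* Defs.v *)
From HB Require Import structures.
From mathcomp Require Import all_boot all_order all_algebra.
From mathcomp Require Import reals.
Set Implicit Arguments. Unset Strict Implicit. Unset Printing Implicit Defensive.
Import Order.TTheory GRing.Theory Num.Theory.
Local Open Scope ring_scope.

(* A (representation of a) d-interval: d pairs (a_j, b_j); the d-interval is
   the union of the closed intervals [a_j, b_j]. *)
Definition dint (R : realType) (d : nat) := {ffun 'I_d -> R * R}.

Definition dint_wf (R : realType) d (h : dint R d) : bool :=
  [forall j, (h j).1 <= (h j).2].

(* separated d-interval: component h^{j+1} (index j : 'I_d) lies in (j, j+1);
   components are then automatically pairwise disjoint. *)
Definition dint_sep (R : realType) d (h : dint R d) : bool :=
  [forall j, [&& (h j).1 <= (h j).2, (nat_of_ord j)%:R < (h j).1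
                 & (h j).2 < (nat_of_ord j)%:R + 1]].

Definition in_dint (R : realType) d (h : dint R d) (x : R) : bool :=
  [exists j, ((h j).1 <= x) && (x <= (h j).2)].

Definition union_fam (R : realType) d n (F : 'I_n -> seq (dint R d))
  (I : {set 'I_n}) : seq (dint R d) :=
  flatten [seq F i | i <- enum I].

Definition is_cover (R : realType) d (H : seq (dint R d)) (C : seq R) : Prop :=
  forall e, e \in H -> exists2 x, x \in C & in_dint e x.

Definition tau_ge (R : realType) d (H : seq (dint R d)) (k : nat) : Prop :=
  forall C : seq R, uniq C -> is_cover H C -> (k <= size C)%N.

Definition colorful_matching (R : realType) d n (F : 'I_n -> seq (dint R d))
  (M : seq ('I_n * dint R d)) : Prop :=
  [/\ uniq (map fst M),
      (forall p, p \in M -> p.2 \in F p.1) &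
      (forall p q, p \in M -> q \in M -> p.1 != q.1 ->
         forall x : R, ~~ (in_dint p.2 x && in_dint q.2 x))].

(* Main.v *)
Require Import Defs.
From HB Require Import structures.
From mathcomp Require Import all_boot all_order all_algebra.
From mathcomp Require Import reals boolp zify lra.

(* A d-interval avoiding a set of cuts of the line marks the gaps between
   consecutive cuts that contain its components.  At every position of the cuts
   the hypothesis on tau leaves more good colors (colors having an edge that
   avoids all cuts) than there are cuts.  The cuts live on a grid whose odd
   points are the interval endpoints and whose even points are the open gaps
   between them.  Along a simplex of the barycentric subdivision of this cubical
   grid the set of good colors grows while the number of odd coordinates drops,
   so choosing the good color whose rank is that number gives distinct vertices
   of a simplex distinct colors.  A discrete Poincare-Miranda theorem, obtained
   from a Scarf-type parity argument, then produces a simplex and weights on its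
   vertices for which every gap receives almost the same mass: an almost perfect
   fractional matching of the marked sets, with distinct colors.  By Fueredi's
   argument it yields an integral matching: a fractional matching of minimal
   support has an edge of weight at least 1/d (1/(d-1) in the d-partite case),
   and such edges can be chosen greedily.  Disjoint marked sets come from
   disjoint edges, and integrality absorbs the approximation error. *)

Set Implicit Arguments. Unset Strict Implicit. Unset Printing Implicit Defensive.
Import Order.TTheory GRing.Theory Num.Theory.

(** * Scarf's combinatorial lemma *)

(** A surjection onto a set with one element fewer identifies exactly one pair, and only a member of
    that pair can be deleted without losing the image. It is applied to labels and, in
    [card_extensions], to minima. *)
Lemma imset_collision (A B : finType) (f : A -> B) (s : {set A}) (b : {set B}) :
  f @: s = b -> #|s| = #|b|.+1 ->
  exists x y, [/\ x != y, {in s :\ x &, injective f}, {in s :\ y &, injective f} &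
    [set z in s | f @: (s :\ z) == b] = [set x; y]].
Proof.
move=> fs cs.
have /dinjectivePn [x xs [y /andP[yx ys] fxy]] : ~~ dinjectiveb f s.
  by apply/negP => /dinjectiveP/card_in_imset; rewrite fs cs => /n_Sn.
have del z z' : z \in s -> z' \in s -> z != z' -> f z = f z' ->
    f @: (s :\ z) = b /\ {in s :\ z &, injective f}.
  move=> zs z's zz' fz.
  have im : f @: (s :\ z) = b.
    rewrite -fs; apply/setP => w; apply/imsetP/imsetP => -[v].
      by rewrite 2!inE => /andP[_ vs] ->; exists v.
    move=> vs ->; have [->|vz] := eqVneq v z.
      by exists z' => //; rewrite 2!inE eq_sym zz'.
    by exists v => //; rewrite 2!inE vz.
  split=> //; apply/imset_injP; rewrite im.
  by move: (cardsD1 z s); rewrite zs cs add1n => -[->].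
rewrite /= in yx ys.
have [imx injx] := del x y xs ys (contra_neq esym yx) fxy.
have [imy injy] := del y x ys xs yx (esym fxy).
exists x, y; split; rewrite // ?(eq_sym x) //.
apply/setP => z; rewrite !inE; apply/andP/orP; last first.
  by case=> /eqP ->; rewrite ?imx ?imy.
move=> [zs /eqP imz]; apply/orP; apply: contraT; rewrite negb_or => /andP[zx zy].
have : f z \in f @: (s :\ z) by rewrite imz -fs imset_f.
case/imsetP => w; rewrite 2!inE => /andP[wz ws] fzw.
have [wx|wx] := eqVneq w x.
  by case/eqP: zy; apply: injx; rewrite ?inE ?zx ?zs ?ys ?yx // fzw wx.
by case/eqP: wz; apply/esym; apply: injx; rewrite ?inE ?zx ?zs ?ws ?wx.
Qed.

(* [U] consists of points and of one slack element [sl i] per index; [sl i] is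
   the least element of the order [u i] and lies above all points in the others. *)
Section Scarf.
Variables (U I : finType) (u : I -> U -> nat) (sl : I -> U) (f : U -> I) (i0 : I).
Hypothesis u_inj : forall i, injective (u i).
Hypothesis u_sl : forall i z, z != sl i -> u i (sl i) < u i z.
Hypothesis u_slN : forall i j z, z \notin codom sl -> j != i -> u i z < u i (sl j).
Hypothesis f_sl : forall i, f (sl i) = i.

(** Scarf's dominating sets: no element of [U] exceeds the minimum of [s] in all the orders at
    once. *)
Definition dominating (s : {set U}) :=
  [forall x, exists i, [forall t in s, u i x <= u i t]].

Lemma dominatingP (s : {set U}) :
  reflect (forall x, exists i, {in s, forall t, u i x <= u i t}) (dominating s).
Proof.
apply: (iffP forallP) => H x; have := H x.
  by case/existsP => i /forall_inP; exists i.
by case=> i Hi; apply/existsP; exists i; apply/forall_inP.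
Qed.

Lemma dominatingS (s t : {set U}) : s \subset t -> dominating t -> dominating s.
Proof.
move=> /subsetP st /dominatingP H; apply/dominatingP => x.
by have [i Hi] := H x; exists i => z /st/Hi.
Qed.

Definition extensions (t : {set U}) := [set z | (z \notin t) && dominating (z |: t)].

(** For [i != i0] the least element [sl i] of [u i] is in the facet, so elements outside it can be
    dominated only through [i0]. The added element must therefore be the [u i0]-maximum outside the
    facet. *)
Lemma card_extensions_slack : #|extensions (sl @: (~: [set i0]))| = 1.
Proof.
set t0 := sl @: _.
have sl_inj : injective sl := can_inj f_sl.
have slt0 i : (sl i \in t0) = (i != i0) by rewrite mem_imset // !inE.
have notin : sl i0 \notin t0 by rewrite slt0 eqxx.
pose z := [arg max_(z > sl i0 | z \notin t0) u i0 z].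
have [zt0 zmax] : z \notin t0 /\ forall x, x \notin t0 -> u i0 x <= u i0 z.
  by rewrite /z; case: arg_maxnP.
apply/eqP/cards1P; exists z; apply/setP => y; rewrite !inE.
apply/andP/eqP => [[yt0 /dominatingP dy]|->].
  have [i Hi] := dy z.
  have ii0 : i = i0.
    apply/eqP; apply: contraT => ii0.
    have := Hi (sl i); rewrite !inE slt0 ii0 orbT => /(_ isT).
    rewrite leqNgt u_sl //; apply: contra zt0 => /eqP ->.
    by rewrite slt0.
  rewrite ii0 in Hi; apply: (@u_inj i0); apply/eqP; rewrite eqn_leq zmax //=.
  by apply: Hi; rewrite !inE eqxx.
split=> //; apply/dominatingP => x.
have [|xt0] := boolP (x \in t0).
  case/imsetP => i _ ->; exists i => t _.
  by have [->//|/u_sl/ltnW] := eqVneq t (sl i).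
exists i0 => t; rewrite !inE => /predU1P[->|]; first exact: zmax.
case/imsetP => i; rewrite !inE => ii0 ->.
have [/codomP[j xj]|xN] := boolP (x \in codom sl); last exact/ltnW/u_slN.
move: xt0; rewrite xj slt0 negbK => /eqP ->.
by apply/ltnW/u_sl; rewrite (inj_eq sl_inj).
Qed.

(** A dominating [t] consists of its minima in the various orders; as it has one element fewer than
    there are indices, exactly two indices share their minimum. An extension becomes the minimum at
    one of these two, where it is the largest element exceeding the minima of [t] in all other
    orders. Hence there are two extensions, or none if [t] is not dominating. *)
Lemma card_extensions (t : {set U}) : f @: t = ~: [set i0] -> #|t|.+1 = #|I| ->
  t != sl @: (~: [set i0]) -> ~~ odd #|extensions t|.
Proof.
move=> ft ct tN.
have ctC : #|t| = #|~: [set i0]| by rewrite cardsC1 -ct.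
(* A non-slack element of [t] is what puts [sl k] into [M k] below, so that the maxima [z k]
   exist. *)
have [x0 x0t x0N] : exists2 x, x \in t & x \notin codom sl.
  apply/exists_inP; apply: contraT; rewrite negb_exists => /forallP H.
  case/eqP: tN; apply/eqP; rewrite eqEcard ctC leq_imset_card andbT.
  apply/subsetP => x xt; have := H x; rewrite xt negbK => /codomP[i xi].
  by rewrite xi imset_f // -ft; apply/imsetP; exists x; rewrite // xi f_sl.
have [dt|/negP dt] := boolP (dominating t); last first.
  suff -> : extensions t = set0 by rewrite cards0.
  apply/setP => z; rewrite !inE; apply/negP => /andP[_ dz]; apply: dt.
  exact: dominatingS (subsetU1 _ _) dz.
pose m i := [arg min_(z < x0 in t) u i z].
have [mt mmin] : (forall i, m i \in t) /\ (forall i z, z \in t -> u i (m i) <= u i z).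
  by split=> i; rewrite /m; case: arg_minnP.
have mP i z : z \in t -> (forall w, w \in t -> u i z <= u i w) -> m i = z.
  move=> zt zmin; apply: (@u_inj i); apply/eqP.
  by rewrite eqn_leq mmin // zmin.
have mim : m @: [set: I] = t.
  apply/setP => z; apply/imsetP/idP => [[i _ ->//]|zt].
  have /dominatingP/(_ z)[i zi] := dt; exists i => //.
  by rewrite (mP i z).
have [|j [j' [jj' injj injj' mdel]]] := imset_collision mim.
  by rewrite cardsT ct.
pose M j := [set x | [forall (i | i != j), u i (m i) < u i x]].
have MP k x : reflect (forall i, i != k -> u i (m i) < u i x) (x \in M k).
  by rewrite inE; apply: forall_inP.
have slM k : sl k \in M k.
  apply/MP => i ik; apply: leq_ltn_trans (mmin i x0 x0t) _.
  by apply: u_slN; rewrite // eq_sym.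
pose z k := [arg max_(x > sl k in M k) u k x].
have [zM zmax] : (forall k, z k \in M k) /\ (forall k x, x \in M k -> u k x <= u k (z k)).
  by split=> k; rewrite /z; case: arg_maxnP => //.
have notM k x : x \in M k -> {in t, forall w, u k x <= u k w}.
  move=> xM; have /dominatingP/(_ x)[i xi] := dt.
  have [<-//|ik] := eqVneq i k.
  by have := MP _ _ xM i ik; rewrite ltnNge xi ?mt.
have ext k : m @: ([set: I] :\ k) = t -> z k \in extensions t.
  move=> mk; rewrite inE; apply/andP; split.
    rewrite -mk; apply/imsetP => -[i]; rewrite !inE andbT => ik zi.
    by have := MP _ _ (zM k) i ik; rewrite zi ltnn.
  apply/dominatingP => x; have [xM|] := boolP (x \in M k).
    exists k => w; rewrite !inE => /predU1P[->|wt]; first exact: zmax.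
    exact: notM.
  rewrite inE => /forallPn[i]; rewrite negb_imply -leqNgt => /andP[ik xi].
  exists i => w; rewrite !inE => /predU1P[->|wt]; apply: leq_trans xi _.
    exact/ltnW/(MP _ _ (zM k)).
  exact: mmin.
have inmdel k : (k \in [set j; j']) = (m @: ([set: I] :\ k) == t).
  by rewrite -mdel 2!inE.
suff -> : extensions t = [set z j; z j'].
  rewrite cards2 (_ : z j != z j') //; apply/eqP => zz.
  have /dominatingP/(_ (z j))[i] := dt.
  have [-> /(_ (m j) (mt j))|ij /(_ (m i) (mt i))] := eqVneq i j.
    by rewrite zz leqNgt (MP _ _ (zM j')).
  by rewrite leqNgt (MP _ _ (zM j)).
apply/setP => y; rewrite in_set2; apply/idP/orP; last first.
  by case=> /eqP ->; apply/ext/eqP; rewrite -inmdel !inE eqxx ?orbT.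
rewrite inE => /andP[yt /dominatingP dy].
(* At [i1] the new element [y] is the minimum, so each element of [t] must be a minimum at another
   index; hence [i1] is one of the two sharing indices. *)
have [i1 yi1] := dy y.
have pick v : v \in t -> exists i, [/\ i != i1, m i = v & u i v < u i y].
  move=> vt; have [i vi] := dy v; exists i.
  have lt_vy : u i v < u i y.
    rewrite ltn_neqAle vi ?setU11 // andbT; apply: contra yt => /eqP/u_inj <-.
    by [].
  split=> //; last first.
    by apply: mP => // w wt; apply: vi; rewrite inE wt orbT.
  apply: contraTneq lt_vy => ->; rewrite -leqNgt; apply: yi1.
  by rewrite inE vt orbT.
have mi1 : m @: ([set: I] :\ i1) = t.
  apply/setP => v; apply/imsetP/idP => [[i _ ->//]|/pick[i [ii1 mi _]]].
  by exists i; rewrite // !inE ii1.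
have i1j : i1 \in [set j; j'] by rewrite inmdel mi1.
have inji1 : {in [set: I] :\ i1 &, injective m}.
  by move: i1j; rewrite !inE => /orP[]/eqP ->.
have yM : y \in M i1.
  apply/MP => i ii1; have [k [ki1 mk]] := pick (m i) (mt i).
  by rewrite (_ : k = i) //; apply: inji1; rewrite // !inE ?ki1 ?ii1.
have : y = z i1.
  apply: (@u_inj i1); apply/eqP; rewrite eqn_leq zmax //=.
  have [i] := dy (z i1); have [-> zi|ii1 zi] := eqVneq i i1.
    by apply: zi; rewrite setU11.
  have := MP _ _ (zM i1) i ii1; rewrite ltnNge zi //.
  by rewrite inE mt orbT.
by move: i1j; rewrite !inE => /orP[]/eqP -> ->; [left|right].
Qed.

(* Counts modulo 2 the pairs (s, z) with s dominating of size #|I|, z in s and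
   f (s \ z) = I \ i0: each s without all labels has 0 or 2 such z, whereas each
   s \ z has an even number of extensions, except for the set of all slack
   elements other than [sl i0], which has exactly one. *)
Lemma dominating_rainbow : exists2 s, dominating s & f @: s = [set: I].
Proof.
pose full (s : {set U}) := dominating s && (f @: s == [set: I]).
have [/existsP[s /andP[ds /eqP fs]]|/existsPn nofull] := boolP [exists s, full s].
  by exists s.
pose B := ~: [set i0].
have cB : #|B|.+1 = #|I| by rewrite cardsC1 prednK //; apply/card_gt0P; exists i0.
pose P (s : {set U}) z := [&& z \in s, dominating s, #|s| == #|I| & f @: (s :\ z) == B].
have even s : ~~ odd (\sum_(z | P s z) 1).
  rewrite sum1dep_card.
  have [/andP[ds cs]|] := boolP (dominating s && (#|s| == #|I|)); last first.
    move=> dcs; rewrite (_ : [set z | P s z] = set0) ?cards0 //.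
    apply/setP => z; rewrite !inE; apply: contraNF dcs.
    by case/and4P => _ -> -> _.
  have [->|[z0]] := set_0Vmem [set z | P s z]; first by rewrite cards0.
  rewrite inE => /and4P[z0s _ _ /eqP fz0].
  have fs : f @: s = B.
    have := nofull s; rewrite /full ds /= => fsT; apply/eqP.
    rewrite eq_sym eqEcard -{1}fz0 imsetS ?subsetDl //= -ltnS cB -cardsT.
    by rewrite proper_card // properT.
  have [|x [y [xy _ _ eq_xy]]] := imset_collision fs.
    by rewrite cB (eqP cs).
  rewrite (_ : [set z | P s z] = [set x; y]) ?cards2 ?xy // -eq_xy.
  by apply/setP => z; rewrite !inE /P ds cs.
pose D := [set t : {set U} | (#|t|.+1 == #|I|) && (f @: t == B)].
have : \sum_s \sum_(z | P s z) 1 = \sum_(t in D) #|extensions t|.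
  rewrite (exchange_big_dep xpredT) //=.
  under [RHS]eq_bigr do rewrite -sum1_card.
  rewrite [RHS](exchange_big_dep xpredT) //=; apply: eq_bigr => z _.
  rewrite (reindex_onto (fun t => z |: t) (fun s => s :\ z)) /=; last first.
    by move=> s /andP[zs _]; rewrite setD1K.
  apply: eq_bigl => t; rewrite /P !inE eqxx /=.
  have [zt|zt] := boolP (z \in t); rewrite ?andbF /=.
    apply/negP => /andP[_ /eqP] tz.
    by move: zt; rewrite -tz !inE eqxx.
  by rewrite setU1K // eqxx andbT cardsU1 zt add1n [RHS]andbC andbA.
move/(congr1 odd); rewrite (big_morph odd oddD (erefl _)) big1 => [|s _]; last first.
  exact/negbTE.
have slD : sl @: B \in D.
  rewrite inE card_imset ?cB ?eqxx /=; last exact: can_inj f_sl.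
  by rewrite -imset_comp (eq_imset (g := id)) ?imset_id.
rewrite (bigD1 _ slD) /= oddD card_extensions_slack.
rewrite (big_morph odd oddD (erefl _)) big1 // => t /andP[tD tN].
have : t \in D by []; rewrite inE => /andP[/eqP ct /eqP ft].
exact/negbTE/card_extensions.
Qed.
End Scarf.

(** * A discrete Poincare-Miranda theorem *)

Section Cube.
Variables (J : finType) (K : nat).
Local Notation X := {ffun J -> 'I_K.+1}.
Variable neg : J -> X -> bool.
Hypothesis neg_top : forall j (y : X), y j = K :> nat -> ~~ neg j y.
Hypothesis neg_bot : forall j (y : X), y j <= #|J| -> neg j y.

Let val (i : option J) (x : X) : nat :=
  if i is Some j then x j else \sum_j (K - x j).

Let big := (K + #|J| * K).+1 * #|{: X}|.

(** Scaling [val i] by the number of points and adding [enum_rank] breaks ties. A slack element is 0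
    in its own order and above [big], hence above all points, in the others. *)
Let u (i : option J) (z : X + option J) : nat :=
  match z with
  | inl x => (val i x * #|{: X}| + enum_rank x).+1
  | inr i' => if i' == i then 0 else (big + enum_rank i').+1
  end.

Let lab (z : X + option J) : option J :=
  match z with inl x => [pick j | neg j x] | inr i => i end.

Let val_le i x : val i x <= K + #|J| * K.
Proof.
case: i => [j|] /=; first by have := ltn_ord (x j); lia.
apply: leq_trans (leq_addl _ _); rewrite -sum_nat_const.
by apply: leq_sum => j _; rewrite leq_subr.
Qed.

Let u_inl i x : u i (inl x) <= big.
Proof.
rewrite /= /big; have := val_le i x; have := ltn_ord (enum_rank x).
set n := #|_|; nia.
Qed.

Let u_inj i : injective (u i).
Proof.
case=> [x|a] [y|b]; last 1 first.
- rewrite /=; case: (eqVneq a i) => [->|ai]; case: (eqVneq b i) => [->|bi] //.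
  by case=> /addnI/ord_inj/enum_rank_inj ->.
- rewrite [u i (inl _)]/= [u i _]/= => -[]; set n := #|_| => e.
  suff : enum_rank x = enum_rank y by move/enum_rank_inj ->.
  apply/ord_inj; have := ltn_ord (enum_rank x); have := ltn_ord (enum_rank y).
  by move=> /modn_small <- /modn_small <-; rewrite -/n -(modnMDl (val i x)) e modnMDl.
- move=> e; have := u_inl i x; rewrite e /=; move: e => /=.
  by case: (b == i) => // _; rewrite ltnNge leq_addr.
- move=> e; have := u_inl i y; rewrite -e /=; move: e => /=.
  by case: (a == i) => // _; rewrite ltnNge leq_addr.
Qed.

Let u_val i x y : u i (inl x) <= u i (inl y) -> val i x <= val i y.
Proof.
rewrite /= ltnS; have := ltn_ord (enum_rank x); have := ltn_ord (enum_rank y).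
set n := #|_|; nia.
Qed.

(* Scarf's lemma for the orders given by the coordinates and by minus their sum
   (index [None]), a point being labelled by some [j] with [neg j], if any. *)
Lemma cube_sign_change : exists2 t0 : X, (forall j, ~~ neg j t0) &
  forall j, exists2 t : X, neg j t & forall i, t i <= t0 i + #|J| /\ t0 i <= t i + #|J|.
Proof.
have [|||s /dominatingP ds fs] :=
    @dominating_rainbow _ _ u (@inr X (option J)) lab None u_inj.
- move=> i [x|a] //=; rewrite eqxx // => ai.
  by rewrite ifN //; apply: contra ai => /eqP ->.
- move=> i j [x _ ji|a /negP[]]; last exact: codom_f.
  by apply: leq_ltn_trans (u_inl i x) _; rewrite /= (negbTE ji) ltnS leq_addr.
- by [].
have labelled i : inr i \notin s -> exists2 x, inl x \in s & lab (inl x) = i.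
  move=> iN; have : i \in lab @: s by rewrite fs inE.
  case/imsetP => -[x|a] zs e; first by exists x.
  by move: iN; rewrite e zs.
have labS j x : lab (inl x) = Some j -> neg j x.
  by rewrite /=; case: pickP => // j' ? [<-].
have N0 : inr None \notin s.
  (* The top corner is tested: domination through [Some j] would need a point of [s] labelled [j] at
     height [K], against [neg_top]. *)
  apply/negP => s0; have [[j|] Hi] := ds (inl [ffun=> ord_max]); last first.
    by have := Hi _ s0.
  have [sj|/labelled[x xs /labS xj]] := boolP (inr (Some j) \in s).
    by have := Hi _ sj; rewrite /= eqxx.
  have := u_val (Hi _ xs); rewrite /= ffunE /= => Kx.
  have /neg_top : x j = K :> nat by apply/eqP; rewrite eqn_leq Kx -ltnS ltn_ord.
  by rewrite xj.
have [t0 t0s lab0] := labelled _ N0.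
have t0N j : ~~ neg j t0.
  by move: lab0 => /=; case: pickP => // ->.
pose m j := [arg min_(t < t0 | inl t \in s) nat_of_ord (t j)].
have [ms mmin] : (forall j, inl (m j) \in s) /\
    (forall j t, inl t \in s -> m j j <= t j).
  by split=> j; rewrite /m; case: arg_minnP.
have mK j : inr (Some j) \notin s -> m j j < K.
  move=> /labelled[x xs /labS xj]; apply: leq_ltn_trans (mmin j x xs) _.
  have : (x j : nat) != K by apply: contraL xj => /eqP; apply: neg_top.
  by have := ltn_ord (x j); lia.
(* This point lies just above the minimum of [s] in each coordinate, so it can be dominated only
   through [None]: its coordinate sum is at least that of every point of [s]. As it exceeds these
   points by at most one per coordinate, all points of [s] are close together. *)
pose x : X := [ffun j => if inr (Some j) \in s then ord0 else inord (m j j).+1].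
have xE j : x j = (if inr (Some j) \in s then 0 else (m j j).+1) :> nat.
  by rewrite ffunE; case: ifPn => // jN; rewrite inordK // ltnS mK.
have x_le t j : inl t \in s -> x j <= (t j).+1.
  by move=> ts; rewrite xE; case: ifP => // _; rewrite ltnS mmin.
have sum_le t : inl t \in s -> \sum_j (t j : nat) <= \sum_j (x j : nat).
  have [[j|] Hi] := ds (inl x).
    have [sj|sj] := boolP (inr (Some j) \in s).
      by have := Hi _ sj; rewrite /= eqxx.
    by have := u_val (Hi _ (ms j)); rewrite /= xE (negbTE sj) ltnn.
  move=> ts; have := u_val (Hi _ ts); rewrite /=.
  have e (y : X) : \sum_j (K - y j) + \sum_j (y j : nat) = #|J| * K.
    rewrite -big_split /= -sum_nat_const; apply: eq_bigr => j _.
    by have := ltn_ord (y j); lia.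
  by have := e x; have := e t; lia.
have t_le t j : inl t \in s -> t j < x j + #|J|.
  move=> ts; have := sum_le t ts; rewrite (bigD1 j) //= [X in _ <= X](bigD1 j) //=.
  have : \sum_(i | i != j) (x i : nat) <= \sum_(i | i != j) (t i).+1.
    by apply: leq_sum => i _; apply: x_le.
  under [X in _ <= X]eq_bigr do rewrite -addn1.
  rewrite big_split /= sum1_card (cardC1 j).
  have : 0 < #|J| by apply/card_gt0P; exists j.
  move: (\sum_(i | i != j) _) (\sum_(i | i != j) _) #|J| => a b n; lia.
have sN j : inr (Some j) \notin s.
  apply/negP => sj; have := t_le t0 j t0s; rewrite xE sj add0n => /ltnW/neg_bot.
  exact/negP.
exists t0 => // j; have [t ts tj] := labelled _ (sN j).
exists t; first exact: labS.
move=> i; move: (t_le _ i ts) (t_le _ i t0s) (x_le _ i ts) (x_le _ i t0s).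
by move: (x i : nat) (t i : nat) (t0 i : nat) #|J| => a b c n; lia.
Qed.
End Cube.

(** * Rounding a fine grid to a coarse one *)

(* With s the distance from y to the nearest multiple of 2M, y / M is rounded to
   the odd integer next to it if th < s, and to the nearest even integer otherwise;
   y / M is thus the average of its roundings over th < M. *)
Definition rnd (M th y : nat) : nat :=
  2 * (y %/ (2 * M)) + (th < y %% (2 * M)) + (2 * M - th <= y %% (2 * M)).

Section Rounding.
Variables (M th : nat).
Hypothesis lt_thM : th < M.

Lemma rnd0 : rnd M th 0 = 0.
Proof. by rewrite /rnd div0n mod0n; lia. Qed.

Lemma rnd_top N : rnd M th (2 * M * N) = 2 * N.
Proof. by rewrite /rnd mulKn ?modnMr; lia. Qed.

Lemma rnd_mono y y' : y <= y' -> rnd M th y <= rnd M th y'.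
Proof.
move=> le_yy'; have le_q : y %/ (2 * M) <= y' %/ (2 * M) by apply: leq_div2r.
have [lt_q|ge_q] := ltnP (y %/ (2 * M)) (y' %/ (2 * M)).
  by rewrite /rnd; lia.
have e : y %/ (2 * M) = y' %/ (2 * M) by apply/eqP; rewrite eqn_leq le_q.
have le_r : y %% (2 * M) <= y' %% (2 * M).
  by move: le_yy'; rewrite {1}(divn_eq y (2 * M)) {1}(divn_eq y' (2 * M)) e leq_add2l.
by rewrite /rnd e; lia.
Qed.

(** Raising the threshold only moves odd values to adjacent even ones, so the roundings of a grid
    point are the vertices of one simplex of the barycentric subdivision. *)
Lemma rnd_chain th' y : th <= th' < M -> rnd M th y != rnd M th' y ->
  [/\ odd (rnd M th y), ~~ odd (rnd M th' y) &
      rnd M th' y = (rnd M th y).+1 \/ rnd M th y = (rnd M th' y).+1].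
Proof. by rewrite /rnd => H1 H2; split; lia. Qed.
End Rounding.

Lemma rnd_step M y : exists th0, forall th, th < M -> th != th0 ->
  rnd M th y.+1 = rnd M th y.
Proof.
pose r := y %% (2 * M).
(* The distances of [y] and [y.+1] to the nearest multiple of [2 * M] differ by one; only the
   threshold equal to the smaller distance separates them. *)
exists (if r < M then r else 2 * M - r.+1) => th lt_thM th0.
have lt_r : r < 2 * M by rewrite ltn_mod; lia.
have m_gt0 : 0 < 2 * M by lia.
rewrite /rnd -/r; set q := y %/ (2 * M).
have -> : y.+1 = q * (2 * M) + r.+1 by rewrite addnS -divn_eq.
rewrite divnMDl // modnMDl.
have [lt_rS|ge_rS] := ltnP r.+1 (2 * M).
  rewrite (divn_small lt_rS) (modn_small lt_rS) addn0.
  by move: th0; case: ifP => ? ?; lia.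
have -> : r.+1 = 2 * M by lia.
rewrite modnn divnn m_gt0.
by move: th0; case: ifP => ? ?; lia.
Qed.

(** Each unit step affects at most one threshold; the two truncated differences add up to the
    distance of [y] and [y']. *)
Lemma card_rnd_change M y y' :
  #|[set th : 'I_M | rnd M th y != rnd M th y']| <= (y - y') + (y' - y).
Proof.
wlog le_yy' : y y' / y <= y'.
  move=> H; have [/H//|/ltnW/H] := leqP y y'.
  by rewrite addnC; under eq_finset do rewrite eq_sym.
rewrite (eqP le_yy') add0n -{1}(subnKC le_yy').
elim: (y' - y) => [|n IHn].
  by rewrite addn0 leqn0 cards_eq0; apply/eqP/setP => th; rewrite !inE eqxx.
have [th0 th0P] := rnd_step M (y + n).
rewrite addnS.
have [lt_th0|ge_th0] := ltnP th0 M; last first.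
  apply: leq_trans (leqnSn n); apply: leq_trans IHn.
  apply: subset_leq_card; apply/subsetP => th; rewrite !inE th0P //.
  by have := ltn_ord th; lia.
rewrite -[n.+1]add1n; apply: leq_trans (leq_add (leqnn 1) IHn).
rewrite -[X in _ <= X + _](cards1 (Ordinal lt_th0)); apply: leq_trans (leq_card_setU _ _).
apply: subset_leq_card; apply/subsetP => th; rewrite !inE -val_eqE /=.
by have [//|ne] := eqVneq (th : nat) th0; rewrite (th0P _ (ltn_ord th) ne).
Qed.

Local Open Scope ring_scope.

(** * Fractional matchings *)

(** The ratio test of linear programming: [t] is the least ratio [a x / - b x] over the decreasing
    coordinates. *)
Lemma first_zero (R : realFieldType) (X : finType) (a b : X -> R) :
  (forall x, 0 <= a x) -> (forall x, a x = 0 -> b x = 0) -> (exists x, b x < 0) ->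
  exists2 t, 0 < t & (forall x, 0 <= a x + t * b x) /\
    exists2 x, a x != 0 & a x + t * b x = 0.
Proof.
move=> a0 ab [x0 bx0].
have [x bx xmin] := @arg_minP _ _ X x0 (fun x => b x < 0) (fun x => a x / - b x) bx0.
have ax : 0 < a x.
  rewrite lt_neqAle a0 andbT; apply: contraTneq bx => /esym/ab ->.
  by rewrite ltxx.
exists (a x / - b x); first by rewrite divr_gt0 // oppr_gt0.
split=> [y|]; last first.
  exists x; first exact: lt0r_neq0.
  by rewrite invrN mulrN mulNr divfK ?subrr // lt_eqF.
have [by0|by0] := ltP (b y) 0; last first.
  by rewrite addr_ge0 // mulr_ge0 // divr_ge0 // oppr_ge0 ltW.
have := xmin y by0; rewrite ler_pdivlMr ?oppr_gt0 //.
by rewrite mulrN -subr_ge0 opprK.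
Qed.

Section FractionalMatching.
Variables (R : realFieldType) (E V : finType) (T : E -> {set V}).
Hypothesis T_neq0 : forall e, T e != set0.

Definition load (w : E -> R) v := \sum_(e | v \in T e) w e.
Definition fractional (w : E -> R) :=
  (forall e, 0 <= w e) /\ (forall v, load w v <= 1).
Definition supp (w : E -> R) := [set e | w e != 0].
Definition tight (w : E -> R) := [set v | load w v == 1].
(** Extreme points: no nonzero direction keeps all zero weights and all tight loads. *)
Definition basic (w : E -> R) :=
  forall z : E -> R, (forall e, w e = 0 -> z e = 0) ->
    {in tight w, forall v, load z v = 0} -> forall e, z e = 0.

Lemma loadD w z t v : load (fun e => w e + t * z e) v = load w v + t * load z v.
Proof. by rewrite /load mulr_sumr -big_split. Qed.

(** Moving along [z] or its opposite, whichever does not lower the total, until the first constraint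
    becomes an equality either removes an edge from the support or makes a vertex tight. *)
Lemma basic_step w : fractional w ->
  (exists z : E -> R, [/\ (forall e, w e = 0 -> z e = 0),
     {in tight w, forall v, load z v = 0} & exists e, z e != 0]) ->
  exists w', [/\ fractional w', supp w' \subset supp w,
    \sum_e w e <= \sum_e w' e &
    (#|supp w'| + #|~: tight w'| < #|supp w| + #|~: tight w|)%N].
Proof.
move=> [w0 w1] [z [zw ztight [e0 ze0]]].
wlog zpos : z zw ztight ze0 / 0 <= \sum_e z e.
  move=> H; have [/H|/ltW sz] := leP 0 (\sum_e z e); first exact.
  apply: (H (fun e => - z e)).
  - by move=> e /zw ->; rewrite oppr0.
  - by move=> v vt; rewrite /load sumrN -/(load z v) ztight ?oppr0.
  - by rewrite oppr_eq0.
  - by rewrite sumrN oppr_ge0.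
pose a (x : E + V) := match x with inl e => w e | inr v => 1 - load w v end.
pose b (x : E + V) := match x with inl e => z e | inr v => - load z v end.
have [||| t t0 [tpos [x ax tx]]] := @first_zero R _ a b.
- by case=> [e|v] //=; rewrite subr_ge0.
- case=> [e|v] /=; first exact: zw.
  move/eqP; rewrite subr_eq0 eq_sym => lv; rewrite ztight ?oppr0 //.
  by rewrite inE.
(* Some constraint does bind: if no weight decreases, the load grows at any vertex of [e0]. *)
- have [/existsP[e ze]|/existsPn zge0] := boolP [exists e, z e < 0].
    by exists (inl e).
  have zge0' e : 0 <= z e by rewrite leNgt zge0.
  have /set0Pn[v ve0] := T_neq0 e0; exists (inr v) => /=; rewrite oppr_lt0.
  rewrite /load (bigD1 e0) //= ltr_pwDl ?sumr_ge0 //.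
  by rewrite lt_neqAle eq_sym ze0 zge0'.
pose w' e := w e + t * z e; exists w'.
have suppS : supp w' \subset supp w.
  apply/subsetP => e; rewrite !inE; apply: contra => /eqP we.
  by rewrite /w' we zw // mulr0 addr0.
have tightS : ~: tight w' \subset ~: tight w.
  apply/subsetP => v; rewrite !inE; apply: contra => /eqP wv.
  by rewrite loadD wv ztight ?mulr0 ?addr0 // inE wv.
split=> //.
- split=> [e|v]; first exact: (tpos (inl e)).
  by rewrite loadD -subr_ge0; have := tpos (inr v); rewrite /=; lra.
- by rewrite big_split /= -mulr_sumr lerDl mulr_ge0 // ltW.
- case: x ax tx => [e|v] /= ax tx.
    rewrite -addSn leq_add ?subset_leq_card // proper_card //.
    apply/properP; split=> //; exists e; rewrite inE //.
    by rewrite /w' tx eqxx.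
  rewrite -addnS leq_add ?subset_leq_card // proper_card //.
  apply/properP; split=> //; exists v; rewrite !inE.
    by apply: contra ax => /eqP ->; rewrite subrr.
  by rewrite negbK loadD; apply/eqP; lra.
Qed.

Lemma basic_exists w : fractional w ->
  exists w', [/\ fractional w', supp w' \subset supp w,
    \sum_e w e <= \sum_e w' e & basic w'].
Proof.
have [n] := ubnP (#|supp w| + #|~: tight w|); elim: n w => // n IHn w lt_n fw.
case: (pselect (exists z : E -> R, [/\ (forall e, w e = 0 -> z e = 0),
     {in tight w, forall v, load z v = 0} & exists e, z e != 0])) => [hz|nz].
  have [w1 [fw1 sw1 le1 lt1]] := basic_step fw hz.
  have [|w2 [fw2 sw2 le2 bw2]] := IHn w1 _ fw1; first exact: leq_trans lt1 _.
  exists w2; split=> //; first exact: subset_trans sw2 sw1.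
  exact: le_trans le1 le2.
exists w; split=> // z zw zt e; apply/eqP; apply: contra_notT nz => ze.
by exists z; split=> //; exists e.
Qed.

Let deg w v := #|[set e in supp w | v \in T e]|.

Let incidence w : 'M[R]_(#|supp w|, #|tight w|) :=
  \matrix_(i, j) (enum_val j \in T (enum_val i))%:R.

(** A linear relation between rows is a direction keeping zero weights and tight loads, so it
    vanishes. The support is therefore no larger than the tight set. *)
Let incidence_free w : basic w -> row_free (incidence w).
Proof.
move=> bw; apply: inj_row_free => x xA.
pose z e := \sum_(i | enum_val i == e) x 0 i.
have zE i : z (enum_val i) = x 0 i.
  by rewrite /z (bigD1 i) //= big1 ?addr0 // => j /andP[/eqP/enum_val_inj -> /eqP].
have z0 e : w e = 0 -> z e = 0.
  move=> we; apply: big1 => i /eqP ie; have := enum_valP i.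
  by rewrite ie inE we eqxx.
apply/rowP => i; rewrite mxE -zE; apply: bw => // v vt.
have := congr1 (fun B : 'rV_ _ => B 0 (enum_rank_in vt v)) xA.
rewrite !mxE => e; rewrite -[RHS]e {e} /load /z.
rewrite (exchange_big_dep xpredT) //=; apply: eq_bigr => k _.
rewrite mxE enum_rankK_in //.
have [vk|vk] := boolP (v \in T (enum_val k)).
  rewrite mulr1 (big_pred1 (enum_val k)) // => e /=.
  by rewrite eq_sym; case: eqP => [->|//]; rewrite ?vk ?andbF.
rewrite mulr0 big_pred0 // => e.
by rewrite eq_sym; case: eqP => [->|]; rewrite ?(negbTE vk) ?andbF.
Qed.

Let basic_card w : basic w -> (#|supp w| <= #|tight w|)%N.
Proof. by move/incidence_free/eqP => <-; apply: rank_leq_col. Qed.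

Let heavy_of_deg w v n : fractional w -> v \in tight w -> (deg w v <= n)%N ->
  exists e, 1 <= n%:R * w e.
Proof.
move=> [w0 _]; rewrite inE => /eqP lv dv.
have lvS : \sum_(e in [set e in supp w | v \in T e]) w e = 1.
  rewrite -lv /load [RHS](bigID (fun e => w e != 0)) /= [X in _ = _ + X]big1 ?addr0.
    by apply: eq_bigl => e; rewrite !inE andbC.
  by move=> e /andP[_ /negPn/eqP].
apply/existsP; apply: contraT => /existsPn small.
have [e1 e1S] : exists e, e \in [set e in supp w | v \in T e].
  apply/set0Pn; apply: contra_eq_neq lvS => ->.
  by rewrite big_set0 eq_sym oner_neq0.
have : \sum_(e in [set e in supp w | v \in T e]) n%:R * w e < (deg w v)%:R.
  rewrite -[X in _ < X%:R]sum1_card natr_sum; apply: ltr_sum => [|e _].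
    by apply/hasP; exists e1; rewrite ?mem_index_enum.
  by rewrite ltNge.
by rewrite -mulr_sumr lvS mulr1 ltr_nat ltnNge dv.
Qed.

Let double_count w :
  (\sum_(v in tight w) deg w v = \sum_(e in supp w) #|T e :&: tight w|)%N.
Proof.
rewrite /deg; under eq_bigr do rewrite -sum1_card.
rewrite (exchange_big_dep (mem (supp w))) => [|v e _] /=; last by rewrite inE => /andP[].
apply: eq_bigr => e es; rewrite -sum1_card; apply: eq_bigl => v.
by rewrite !inE in es *; rewrite es andbC.
Qed.

(** If all tight vertices had degree above [d], counting incidences would give more supporting edges
    than tight vertices. So some tight vertex has degree at most [d], and its load 1 is shared by at
    most [d] edges. *)
Lemma heavy_edge w d : fractional w -> basic w -> (exists e, w e != 0) ->
  (forall e, #|T e| <= d)%N -> exists e, 1 <= d%:R * w e.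
Proof.
move=> fw bw [e0 we0] Td.
have [/exists_inP[v vt]|/exists_inPn nv] := boolP [exists v in tight w, deg w v <= d]%N.
  exact: heavy_of_deg.
have : (#|tight w| * d.+1 <= #|supp w| * d)%N.
  rewrite -!sum_nat_const; apply: leq_trans (_ : _ <= \sum_(v in tight w) deg w v)%N _.
    by apply: leq_sum => v /nv; rewrite -ltnNge.
  rewrite double_count; apply: leq_sum => e _.
  exact: leq_trans (subset_leq_card (subsetIl _ _)) (Td e).
have := basic_card bw; have : (0 < #|supp w|)%N.
  by apply/card_gt0P; exists e0; rewrite inE.
nia.
Qed.

(* In the partite case the rows of two classes have the same sum, so the square
   incidence matrix of the extremal situation would be singular. *)
Lemma heavy_edge_partite (P : eqType) (part : V -> P) (c0 c1 : P) w d :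
  c0 != c1 -> (forall e, #|T e| <= d)%N ->
  (forall e c, #|[set v in T e | part v == c]| = 1%N) ->
  fractional w -> basic w -> (exists e, w e != 0) -> exists e, 1 <= d.-1%:R * w e.
Proof.
move=> c01 Td Tpart fw bw [e0 we0].
have [/exists_inP[v vt]|/exists_inPn nv] :=
    boolP [exists v in tight w, deg w v <= d.-1]%N; first exact: heavy_of_deg.
have degd v : v \in tight w -> (d <= deg w v)%N by move/nv; lia.
have sum_deg : (#|tight w| * d <= \sum_(v in tight w) deg w v)%N.
  by rewrite -sum_nat_const; apply: leq_sum.
have le_st := basic_card bw.
have TtS e : (#|T e :&: tight w| <= d)%N.
  exact: leq_trans (subset_leq_card (subsetIl _ _)) (Td e).
have d_gt0 : (0 < d)%N.
  by apply: leq_trans (Td e0); rewrite card_gt0.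
have sum_le : (\sum_(e in supp w) #|T e :&: tight w| <= #|supp w| * d)%N.
  by rewrite -sum_nat_const; apply: leq_sum.
(* Both counts of the incidences now agree: the incidence matrix is square and supporting edges
   contain only tight vertices. *)
have e_st : #|supp w| = #|tight w|.
  apply/eqP; rewrite eqn_leq le_st /= -(leq_pmul2r d_gt0).
  by rewrite (leq_trans sum_deg) // double_count.
have T_tight e : e \in supp w -> T e \subset tight w.
  move=> es; suff : #|T e :&: tight w| = d.
    move=> cI; apply/setIidPl/eqP; rewrite eqEcard subsetIl cI.
    exact: Td.
  apply/eqP; rewrite eqn_leq TtS /= leqNgt; apply/negP => lt_d.
  have : (\sum_(e in supp w) #|T e :&: tight w| < \sum_(e in supp w) d)%N.
    rewrite (bigD1 e) //= [X in (_ < X)%N](bigD1 e) //=.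
    by rewrite -addSn leq_add // leq_sum.
  by rewrite sum_nat_const ltnNge e_st -double_count sum_deg.
(* The difference of the indicators of two classes is a nonzero vector in the kernel, since each
   edge meets each class once. *)
pose x : 'cV[R]_#|tight w| :=
  \col_j ((part (enum_val j) == c0)%:R - (part (enum_val j) == c1)%:R).
have Ax : incidence w *m x = 0.
  apply/colP => i; rewrite !mxE.
  pose e := enum_val i; have es : e \in supp w := enum_valP i.
  have cnt c : \sum_(j < #|tight w|) (enum_val j \in T e)%:R * (part (enum_val j) == c)%:R
       = 1 :> R.
    rewrite -(big_enum_val (fun v => (v \in T e)%:R * (part v == c)%:R)) /=.
    rewrite -[RHS]/(1%:R) -[in RHS](Tpart e c) -sum1_card natr_sum.
    rewrite big_mkcond [RHS]big_mkcond; apply: eq_bigr => v _.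
    rewrite [in RHS]inE; have [vT|vT] := boolP (v \in T e); last first.
      by rewrite mul0r; case: ifP.
    by rewrite (subsetP (T_tight e es)) // mul1r; case: (part v == c).
  under eq_bigr do rewrite !mxE mulrBr.
  by rewrite sumrB !cnt subrr.
have /row_free_inj injA : row_free (incidence w)^T.
  by rewrite /row_free mxrank_tr (eqP (incidence_free bw)) e_st.
have x0 : x^T = 0.
  by apply: injA; rewrite -trmx_mul Ax trmx0 mul0mx.
have /card_gt0P[v] : (0 < #|[set v in T e0 | part v == c0]|)%N by rewrite Tpart.
rewrite inE => /andP[vT /eqP vc]; have vt : v \in tight w.
  by apply: (subsetP (T_tight e0 _)); rewrite ?inE.
have := congr1 (fun B : 'rV_ _ => B 0 (enum_rank_in vt v)) x0.
rewrite !mxE enum_rankK_in // vc eqxx (negbTE c01) subr0 => /eqP.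
by rewrite oner_eq0.
Qed.

(** A heavy edge of a basic fractional matching is selected, all edges meeting it lose their weight,
    and the argument recurs on the smaller support. Each selection costs at most [d - (d - 1) / rho]
    of the total weight. *)
Lemma greedy_matching d rho :
  (forall e, #|T e| <= d)%N ->
  (forall w, fractional w -> basic w -> (exists e, w e != 0) ->
     exists e, 1 <= rho%:R * w e) ->
  forall w, fractional w -> exists A : {set E},
    [/\ A \subset supp w, {in A &, forall e f, e != f -> [disjoint T e & T f]} &
        rho%:R * \sum_e w e <= (d * rho - d.-1)%N%:R * #|A|%:R].
Proof.
move=> Td heavy w; have [n] := ubnP #|supp w|; elim: n w => // n IHn w lt_n fw.
have [w' [fw' sw' le_ww' bw']] := basic_exists fw.
have [/existsP[e0 we0]|/existsPn w'0] := boolP [exists e, w' e != 0]; last first.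
  exists set0; split; [exact: sub0set | by move=> e f; rewrite inE |].
  rewrite cards0 mulr0; apply: le_trans (ler_wpM2l (ler0n _ _) le_ww') _.
  by rewrite big1 ?mulr0 // => e _; apply/eqP; move: (w'0 e); rewrite negbK.
have [e he] := heavy w' fw' bw' (ex_intro _ e0 we0).
have [w'ge0 w'le1] := fw'.
have we : w' e != 0 by apply: contraTneq he => ->; rewrite mulr0 ler10.
have rho0 : (0 < rho)%N.
  by rewrite lt0n; apply: contraTneq he => ->; rewrite mul0r ler10.
pose N := [set f | ~~ [disjoint T e & T f]].
have eN : e \in N.
  by rewrite inE disjoints_subset subsets_disjoint setCK; rewrite -setI_eq0 setIid.
pose w2 f := if f \in N then 0 else w' f.
have w2le f : w2 f <= w' f by rewrite /w2; case: ifP.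
have fw2 : fractional w2.
  split=> [f|v]; first by rewrite /w2; case: ifP.
  by apply: le_trans (w'le1 v); apply: ler_sum.
have sw2 : supp w2 \subset supp w.
  apply: subset_trans sw'; apply/subsetP => f; rewrite !inE /w2.
  by case: ifP; rewrite ?eqxx.
have lt2 : (#|supp w2| < n)%N.
  rewrite -ltnS; apply: leq_ltn_trans lt_n; apply: proper_card.
  apply/properP; split=> //; exists e; first by rewrite (subsetP sw') ?inE.
  by rewrite inE /w2 eN eqxx.
have [A [As Adisj Acard]] := IHn w2 lt2 fw2.
have AN f : f \in A -> [disjoint T e & T f].
  by move/(subsetP As); rewrite inE /w2 inE; case: ifP; rewrite ?eqxx // => /negbFE.
have eA : e \notin A.
  by apply/negP => /AN; move: eN; rewrite inE => /negbTE ->.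
exists (e |: A); split.
- apply/subsetP => f; rewrite !inE => /predU1P[->|fA].
    by have := subsetP sw' e; rewrite !inE; apply.
  by have := subsetP (subset_trans As sw2) f fA; rewrite inE.
- move=> f g; rewrite !inE => /predU1P[->|fA] /predU1P[->|gA] fg.
  + by rewrite eqxx in fg.
  + exact: AN.
  + by rewrite disjoint_sym AN.
  + exact: Adisj.
(* Each vertex of [e] leaves at most [1 - w' e] for the other edges, whereas [e] itself is counted
   only once. *)
have removed : \sum_(f in N) w' f <= #|T e|%:R - #|T e|.-1%:R * w' e.
  have : \sum_(f in N) w' f <= w' e + \sum_(v in T e) (1 - w' e).
    rewrite (bigD1 e) //= lerD2l.
    apply: le_trans (_ : _ <= \sum_(v in T e) \sum_(f | (v \in T f) && (f != e)) w' f) _.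
      rewrite (exchange_big_dep (fun f => f != e)) /=; last by move=> v f _ /andP[].
      rewrite big_mkcondl [X in _ <= X]big_mkcond /= [X in X <= _]big_mkcond /=.
      apply: ler_sum => f _; case: ifP => // fe; case: ifP => fN; last first.
        by apply: sumr_ge0.
      move: fN; rewrite inE -setI_eq0 => /set0Pn[v]; rewrite inE => /andP[ve vf].
      by rewrite (bigD1 v) /= ?ve ?vf // lerDl sumr_ge0.
    apply: ler_sum => v ve; rewrite lerBrDl; apply: le_trans (w'le1 v).
    by rewrite /load [X in _ <= X](bigD1 e).
  rewrite sumr_const -mulr_natl; move: (T_neq0 e); rewrite -card_gt0.
  case: #|T e| => // m _; rewrite /= -natr1; lra.
have we1 : w' e <= 1.
  have /set0Pn[v ve] := T_neq0 e; apply: le_trans (w'le1 v).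
  by rewrite /load (bigD1 e) //= lerDl sumr_ge0.
have Te0 : (0 < #|T e|)%N by rewrite card_gt0.
have removed_d : rho%:R * \sum_(f in N) w' f <= (d * rho - d.-1)%N%:R.
  apply: le_trans (ler_wpM2l (ler0n _ _) removed) _.
  have -> : (d * rho - d.-1)%N%:R = rho%:R * d%:R - d.-1%:R :> R.
    rewrite natrB ?natrM 1?mulrC //.
    by rewrite (leq_trans (leq_pred d)) // leq_pmulr.
  have : 0 <= (d%:R - #|T e|%:R) * (rho%:R * (1 - w' e)).
    by rewrite !mulr_ge0 ?subr_ge0 ?ler_nat.
  have eT : (#|T e|.-1%:R : R) = #|T e|%:R - 1.
    by rewrite -[in RHS](prednK Te0) -natr1 addrK.
  have ed : (d.-1%:R : R) = d%:R - 1.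
    by rewrite -[in RHS](prednK (leq_trans Te0 (Td e))) -natr1 addrK.
  have : 0 <= (rho%:R * w' e - 1) * d.-1%:R by rewrite mulr_ge0 // subr_ge0.
  rewrite eT ed; lra.
rewrite cardsU1 eA natrD mulrDr mulr1.
apply: le_trans (ler_wpM2l (ler0n _ _) le_ww') _.
apply: le_trans (lerD removed_d Acard); rewrite -mulrDr ler_wpM2l ?ler0n //.
rewrite (bigID (mem N)) /= lerD2l [X in _ <= X](bigID (mem N)) /=.
rewrite [X in _ <= X + _]big1 ?add0r => [|f fN]; last by rewrite /w2 fN.
by apply: ler_sum => f /negbTE fN; rewrite /w2 fN.
Qed.

End FractionalMatching.

(** * Colorful fractional matchings of d-intervals *)

Lemma mono_lt_succ (R : realDomainType) (f : nat -> R) :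
  (forall i, f i < f i.+1) -> {mono f : i j / (i < j)%N >-> i < j}.
Proof.
move=> fS; have homo : {homo f : i j / (i < j)%N >-> i < j}.
  by apply: homo_ltn => //; apply: lt_trans.
move=> i j; case: (ltngtP i j) => [/homo//|/homo ji|->]; last by rewrite ltxx.
by apply/negbTE; rewrite -leNgt ltW.
Qed.

Lemma grid_exists (R : realFieldType) (s : seq R) : exists N (q : nat -> R),
  {mono q : i j / (i < j)%N >-> i < j} /\
  {in s, forall x, exists2 i, (i < N)%N & x = q i.*2.+1}.
Proof.
pose t := sort <=%R (undup s); pose N := size t.
(* The sorted points are continued by unit steps, so that [q] can be increasing on all of [nat]. *)
pose e i := if (i < N)%N then nth 0 t i else last 0 t + (i - N).+1%:R.
have eS i : e i < e i.+1.
  rewrite /e; have [lt_iS|ge_iS] := ltnP i.+1 N.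
    rewrite (ltn_trans _ lt_iS) //; apply: (sorted_ltn_nth lt_trans) => //.
      by rewrite sort_lt_sorted undup_uniq.
    by rewrite inE (ltn_trans _ lt_iS).
  case: ltnP => lt_i; last by rewrite ltrD2l ltr_nat; lia.
  have -> : i = N.-1 by lia.
  by rewrite nth_last ltrDl ltr0n.
pose q n := if odd n then e n./2 else
  if n is 0%N then e 0%N - 1 else (e n./2.-1 + e n./2) / 2%:R.
exists N, q; split.
  apply: mono_lt_succ => n; rewrite /q /= uphalf_half.
  case: (boolP (odd n)) => /= [on|en].
    by have := eS n./2; rewrite add1n /=; lra.
  rewrite add0n; case: n en => [|n] en; first by rewrite ltrBlDr ltrDl.
  have := eS n.+1./2.-1; rewrite prednK; first lra.
  by move: en => /=; case: n.
move=> x xs; have xt : x \in t by rewrite mem_sort mem_undup.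
exists (index x t); first by rewrite index_mem.
rewrite /q /= odd_double uphalf_double /e index_mem xt.
by rewrite nth_index.
Qed.

Lemma ranked_element n (G : {set 'I_n}) a : (a < #|G|)%N ->
  exists2 x, x \in G & #|[set z in G | (z < x)%N]| = a.
Proof.
have [m] := ubnP #|G|; elim: m G a => // m IHm G a lt_m lt_a.
have [x0 x0G] : exists x0, x0 \in G by apply/card_gt0P; apply: leq_ltn_trans lt_a.
have [x xG xmax] := @arg_maxnP _ x0 (mem G) (fun i => nat_of_ord i) x0G.
have {}xG : x \in G by [].
have {}xmax z : z \in G -> (z <= x)%N by apply: xmax.
have Gx : [set z in G | (z < x)%N] = G :\ x.
  apply/setP => z; rewrite !inE andbC; have [zG|] := boolP (z \in G); rewrite ?andbF //.
  by rewrite !andbT ltn_neqAle val_eqE xmax ?andbT.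
have cG : #|G| = #|G :\ x|.+1 by rewrite (cardsD1 x) xG.
have [->|ne_a] := eqVneq a #|G :\ x|; first by exists x; rewrite ?Gx.
have [||y yG <-] := IHm (G :\ x) a; [by rewrite -ltnS -cG|by lia|].
move: yG; rewrite 2!inE => /andP[yx yG]; exists y => //.
congr #|pred_of_set _|; apply/setP => z; rewrite !inE.
have [->|//] := eqVneq z x; rewrite xG /=.
by apply/negbTE; rewrite -leqNgt xmax.
Qed.

Lemma card_ord_lt n m : (m <= n)%N -> #|[set i : 'I_n | (i < m)%N]| = m.
Proof.
move=> le_mn.
by rewrite -sum1dep_card -(big_ord_widen _ (fun=> 1%N)) // sum1_card card_ord.
Qed.

(** * Cuts, good colors and marked gaps *)

Section Colourful.
Variables (R : realType) (d n P S delta : nat).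
Variables (F : 'I_n -> seq (dint R d)) (part : 'I_d -> 'I_P).
(** Each of the [P] classes of components has its own [S] cuts. Separated intervals will use one
    class per component ([P = d], [delta = 1]), general ones a single class ([P = 1],
    [delta = d]). *)
Local Notation J := ('I_P * 'I_S)%type.
Local Notation vertex := {ffun J -> nat}.
Hypothesis delta_gt0 : (0 < delta)%N.
Hypothesis card_part : forall p, #|[set c | part c == p]| = delta.
Hypothesis F_wf : forall i (h : dint R d) (c : 'I_d), h \in F i -> (h c).1 <= (h c).2.
Hypothesis F_part : forall i i' (h h' : dint R d) (c c' : 'I_d) x,
  h \in F i -> h' \in F i' ->
  (h c).1 <= x <= (h c).2 -> (h' c').1 <= x <= (h' c').2 -> part c = part c'.

Variables (N : nat) (q : nat -> R).
Hypothesis q_mono : {mono q : i j / (i < j)%N >-> i < j}.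
Hypothesis q_left : forall i (h : dint R d) (c : 'I_d), h \in F i ->
  exists2 a, (a < N)%N & (h c).1 = q a.*2.+1.
Hypothesis q_right : forall i (h : dint R d) (c : 'I_d), h \in F i ->
  exists2 a, (a < N)%N & (h c).2 = q a.*2.+1.

Definition avoids (v : vertex) (h : dint R d) := [forall j, ~~ in_dint h (q (v j))].
Definition good (v : vertex) := [set i | has (avoids v) (F i)].
Definition odd_cuts (v : vertex) := [set j | odd (v j)].

Variables (col : vertex -> 'I_n) (edge : vertex -> dint R d).
Hypothesis edge_col : forall v, edge v \in F (col v).
Hypothesis edge_avoids : forall v, avoids v (edge v).
Hypothesis col_rank : forall v,
  #|[set z in good v | (z < col v)%N]| = #|odd_cuts v|.

Let q_le : {mono q : i j / (i <= j)%N >-> i <= j}.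
Proof. by move=> i j; rewrite leNgt q_mono -leqNgt. Qed.

(* Moving a cut from an endpoint (odd position) into an adjacent gap (even
   position) can only enlarge the set of avoiding edges. *)
Lemma good_odd_adjacent (v v' : vertex) :
  (forall j, v j != v' j -> [/\ odd (v j), ~~ odd (v' j) &
     v' j = (v j).+1 \/ v j = (v' j).+1]) ->
  good v \subset good v'.
Proof.
move=> vv'; apply/subsetP => i; rewrite !inE => /hasP[h hF /forallP hv].
apply/hasP; exists h => //; apply/forallP => j.
have [<-//|/vv'[ov ev adj]] := eqVneq (v j) (v' j).
apply: contra (hv j) => /existsP[c /andP[]].
have [a _ ha] := q_left c hF; have [b _ hb] := q_right c hF.
rewrite ha hb !q_le => av vb; apply/existsP; exists c.
by rewrite ha hb !q_le; apply/andP; split; lia.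
Qed.

(** From [v] to [v'] the good set grows, so the rank of a common color could not drop, but the
    number of odd cuts does. *)
Lemma col_odd_adjacent (v v' : vertex) : v != v' ->
  (forall j, v j != v' j -> [/\ odd (v j), ~~ odd (v' j) &
     v' j = (v j).+1 \/ v j = (v' j).+1]) ->
  col v != col v'.
Proof.
move=> ne vv'; apply/eqP => ecol.
have : (#|odd_cuts v| <= #|odd_cuts v'|)%N.
  rewrite -!col_rank ecol subset_leq_card //; apply/subsetP => z.
  rewrite !inE => /andP[zv ->]; rewrite andbT.
  by move: zv (subsetP (good_odd_adjacent vv') z); rewrite !inE => -> ->.
rewrite leqNgt => /negP; case.
have [j vj] : exists j, v j != v' j.
  by apply/existsP; apply: contraR ne; rewrite negb_exists => /forallP H;
     apply/eqP/ffunP => j; apply/eqP; rewrite -[_ == _]negbK.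
apply: proper_card; apply/properP; split; last first.
  by exists j; rewrite inE; have [] := vv' _ vj.
apply/subsetP => i; rewrite !inE => oi.
by have [->//|/vv'[]] := eqVneq (v i) (v' i).
Qed.

(* The masses of the gaps are controlled through the number of components of
   the edge lying to the left of each cut. *)
Definition left_count (v : vertex) (j : J) :=
  #|[set c | (part c == j.1) && ((edge v c).1 < q (v j))]|.

(** Counting the cuts to the left gives the index of the gap containing the component, without
    sorting the cuts. *)
Definition region (v : vertex) (c : 'I_d) : nat :=
  #|[set i : 'I_S | q (v (part c, i)) < (edge v c).1]|.

Lemma region_lt v c : (region v c < S.+1)%N.
Proof. by rewrite ltnS -[leqRHS]card_ord max_card. Qed.

Definition regions (v : vertex) : {set 'I_P * 'I_S.+1} :=
  [set (part c, Ordinal (region_lt v c)) | c : 'I_d].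

Let left_cut (v : vertex) c (j : J) : part c = j.1 ->
  (q (v j) < (edge v c).1) = ~~ ((edge v c).1 < q (v j)).
Proof.
move=> pc; rewrite -leNgt lt_neqAle.
suff -> : q (v j) != (edge v c).1 by [].
apply: contraTneq (forallP (edge_avoids v) j) => e; rewrite negbK.
by apply/existsP; exists c; rewrite e lexx (F_wf c (edge_col v)).
Qed.

(* A common point of two edges may be taken to be a left endpoint, hence a grid
   point of odd index; no cut moves across it when every cut moves by at most
   one grid step. *)
Lemma regions_disjoint (v v' : vertex) :
  (forall j, (v j <= (v' j).+1)%N /\ (v' j <= (v j).+1)%N) ->
  [disjoint regions v & regions v'] ->
  forall x, ~~ (in_dint (edge v) x && in_dint (edge v') x).
Proof.
move=> vv' dis x; apply/negP => /andP[/existsP[c xc] /existsP[c' xc']].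
have pcc := F_part (edge_col v) (edge_col v') xc xc'.
have [z [i zi] [zc zc']] : exists2 z, (exists i, z = q i.*2.+1) &
    (edge v c).1 <= z <= (edge v c).2 /\ (edge v' c').1 <= z <= (edge v' c').2.
  have [a _ ha] := q_left c (edge_col v); have [b _ hb] := q_left c' (edge_col v').
  case/andP: xc => xc1 xc2; case/andP: xc' => xc1' xc2'.
  have [le_cc|/ltW le_cc] := leP (edge v c).1 (edge v' c').1.
    exists (edge v' c').1; first by exists b.
    by rewrite le_cc lexx (le_trans xc1') // (le_trans xc1').
  exists (edge v c).1; first by exists a.
  by rewrite le_cc lexx (le_trans xc1) // (le_trans xc1).
have cut (u : vertex) e y (j : J) : part e = j.1 -> (edge u e).1 <= y <= (edge u e).2 ->
    (q (u j) < (edge u e).1) = (q (u j) < y) /\ q (u j) != y.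
  move=> pe /andP[y1 y2].
  have uN : ~~ ((edge u e).1 <= q (u j) <= (edge u e).2).
    apply: contra (forallP (edge_avoids u) j) => H; apply/existsP.
    by exists e.
  split.
    apply/idP/idP => [lt|lt]; first exact: lt_le_trans lt y1.
    by rewrite ltNge; apply: contra uN => ->; rewrite (le_trans (ltW lt)).
  by apply: contraNneq uN => ->; rewrite y1.
have reg : region v c = region v' c'.
  rewrite /region -pcc; congr #|pred_of_set _|; apply/setP => j; rewrite !inE.
  have [|-> vz] := cut v c z (part c, j) _ zc; first by [].
  have [|-> v'z] := cut v' c' z (part c, j) _ zc'; first by [].
  have /= [h1 h2] := vv' (part c, j).
  have q_neq a b : q a != q b -> a != b by apply: contraNneq => ->.
  move: vz v'z; rewrite zi => /q_neq v1 /q_neq v2; rewrite !q_mono.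
  by move: (v _) (v' _) h1 h2 v1 v2 => a b; lia.
move: dis; rewrite -setI_eq0 => /eqP/setP/(_ (part c, Ordinal (region_lt v c))).
rewrite !inE => /negbT/negP; case; apply/andP; split; apply/imsetP.
  by exists c.
by exists c' => //; rewrite pcc; congr (_, _); apply/ord_inj.
Qed.

(** * Averaging over thresholds and balancing the gaps *)

Section Threshold.
Variable M : nat.
Let D := #|{: J}|.
Hypothesis M_large : (S.+1 ^ 2 * D.+1 ^ 2 <= M)%N.

Let M_gt0 : (0 < M)%N.
Proof. by apply: leq_trans M_large; rewrite muln_gt0 !expn_gt0. Qed.

Let M_big : (S.+1 * D.+1 ^ 2 <= M)%N.
Proof. by apply: leq_trans M_large; rewrite leq_mul // -[leqLHS]expn1 leq_pexp2l. Qed.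

Definition cube := {ffun J -> 'I_(2 * M * N).+1}.
Definition rounded (y : cube) (th : nat) : vertex := [ffun j => rnd M th (y j)].
Definition mass (y : cube) (j : J) : nat :=
  \sum_(th < M) left_count (rounded y th) j.
(** The targets of the cuts of a class are equally spaced, so meeting them gives all its [S.+1] gaps
    the same mass. *)
Definition below_target (j : J) (y : cube) : bool :=
  (S.+1 * mass y j < j.2.+1 * (M * delta))%N.

Let left_count_le v j : (left_count v j <= delta)%N.
Proof.
rewrite -(card_part j.1) subset_leq_card //.
by apply/subsetP => c; rewrite !inE => /andP[].
Qed.

Lemma above_target_top j (y : cube) : y j = (2 * M * N)%N :> nat -> ~~ below_target j y.
Proof.
move=> yj; rewrite /below_target -leqNgt.
suff -> : mass y j = (M * delta)%N by rewrite leq_mul2r ltnS (ltnW (ltn_ord _)) orbT.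
rewrite /mass -[M in RHS]card_ord -sum_nat_const; apply: eq_bigr => th _.
rewrite -(card_part j.1); congr #|pred_of_set _|; apply/setP => c; rewrite !inE.
have [a aN ->] := q_left c (edge_col (rounded y th)).
rewrite ffunE yj rnd_top // q_mono; have -> : (a.*2.+1 < 2 * N)%N by lia.
by rewrite andbT.
Qed.

(** All but at most [D] thresholds round such a coordinate to 0, left of every endpoint. *)
Lemma below_target_bot j (y : cube) : (y j <= D)%N -> below_target j y.
Proof.
move=> yj; rewrite /below_target; have le_mass : (mass y j <= delta * D)%N.
  apply: leq_trans (_ : _ <= \sum_(th < M | rnd M th (y j) != rnd M th 0) delta)%N _.
    rewrite big_mkcond; apply: leq_sum => th _; rewrite rnd0 //.
    case: eqVneq => [e|_] //=; rewrite leqn0 cards_eq0; apply/eqP/setP => c.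
    rewrite !inE ffunE e; have [a _ ->] := q_left c (edge_col (rounded y th)).
    by rewrite q_mono andbF.
  rewrite sum_nat_const mulnC leq_mul2l; apply/orP; right.
  apply: leq_trans yj; have := card_rnd_change M (y j) 0.
  by rewrite subn0 sub0n addn0 cardsE.
nia.
Qed.

(** Each of the [D] coordinates changes its rounding at no more than [D] thresholds, and each
    affected threshold costs at most [delta]. *)
Lemma mass_lipschitz j (y y' : cube) :
  (forall i, (y i <= y' i + D)%N /\ (y' i <= y i + D)%N) ->
  (mass y j <= mass y' j + delta * D ^ 2)%N.
Proof.
move=> yy'.
apply: leq_trans (_ : _ <= \sum_(th < M) (left_count (rounded y' th) j +
   (rounded y th != rounded y' th) * delta))%N _.
  apply: leq_sum => th _; case: eqVneq => [->|_]; first by rewrite leq_addr.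
  by rewrite mul1n addnC (leq_trans (left_count_le _ _)) ?leq_addr.
rewrite big_split /= leq_add2l -big_distrl /= mulnC leq_mul2l; apply/orP; right.
apply: leq_trans (_ : _ <= \sum_(th < M) \sum_i (rnd M th (y i) != rnd M th (y' i)))%N _.
  apply: leq_sum => th _; case: (boolP (rounded _ _ == _)) => // ne.
  have [i yi] : exists i, rounded y th i != rounded y' th i.
    apply/existsP; apply: contraR ne; rewrite negb_exists => /forallP H.
    by apply/eqP/ffunP => i; apply/eqP; rewrite -[_ == _]negbK.
  by move: yi; rewrite !ffunE (bigD1 i) //= => ->.
rewrite exchange_big /=.
apply: leq_trans (_ : _ <= \sum_(i : J) D)%N _; last by rewrite sum_nat_const mulnn.
apply: leq_sum => i _; rewrite -big_mkcond sum1_card -cardsE.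
by apply: leq_trans (card_rnd_change _ _ _) _; have := yy' i; lia.
Qed.

Variable y : cube.
Hypothesis y_pos : forall j, ~~ below_target j y.
Hypothesis y_neg : forall j, exists2 t : cube, below_target j t &
  forall i, (t i <= y i + D)%N /\ (y i <= t i + D)%N.

Let mass_lower (j : J) : (j.2.+1 * (M * delta) <= S.+1 * mass y j)%N.
Proof. by rewrite leqNgt y_pos. Qed.

Let mass_upper (j : J) :
  (S.+1 * mass y j < j.2.+1 * (M * delta) + S.+1 * (delta * D ^ 2))%N.
Proof.
have [t tj ty] := y_neg j.
have : (mass y j <= mass t j + delta * D ^ 2)%N.
  by apply: mass_lipschitz => i; have [] := ty i.
rewrite -(leq_pmul2l (ltn0Sn S)) mulnDr => le_mass.
by apply: leq_ltn_trans le_mass _; rewrite ltn_add2r.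
Qed.

(** Cuts in the wrong order would have masses in the wrong order, but the spacing of the targets
    exceeds the error. *)
Let rounded_sorted th p (i i' : 'I_S) : (th < M)%N -> (i <= i')%N ->
  (rounded y th (p, i) <= rounded y th (p, i'))%N.
Proof.
move=> th_M; rewrite leq_eqVlt => /predU1P[/ord_inj -> //|lt_i].
rewrite !ffunE; apply: rnd_mono => //; rewrite leqNgt; apply/negP => /ltnW le_y.
have : (mass y (p, i') <= mass y (p, i))%N.
  apply: leq_sum => t _; apply: subset_leq_card; apply/subsetP => c.
  rewrite !inE => /andP[-> lt_c]; apply: lt_le_trans lt_c _.
  by rewrite q_le !ffunE rnd_mono.
have := mass_lower (p, i'); have := mass_upper (p, i); rewrite /=.
move: (mass _ _) (mass _ _) => a b; move: delta_gt0 M_big lt_i.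
move: (nat_of_ord i) (nat_of_ord i') D => k k' e.
nia.
Qed.

Let region_le th c (i : 'I_S) : (th < M)%N ->
  (region (rounded y th) c <= i)%N =
  ((edge (rounded y th) c).1 < q (rounded y th (part c, i))).
Proof.
move=> th_M; set v := rounded y th; rewrite /region.
rewrite leqNgt -[RHS]negbK -left_cut //; congr (~~ _).
apply/idP/idP => [|lt_q].
  apply: contraTT; rewrite -leNgt -leqNgt => le_q.
  rewrite -[leqRHS](@card_ord_lt S i) ?(ltnW (ltn_ord i)) // subset_leq_card //.
  apply/subsetP => i'; rewrite !inE => lt_q; rewrite ltnNge.
  apply: contraTN lt_q => /(rounded_sorted (part c) th_M) le_ii'.
  by rewrite -leNgt (le_trans le_q) // q_le.
rewrite -[X in (X <= _)%N](@card_ord_lt S i.+1) // subset_leq_card //.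
apply/subsetP => i'; rewrite !inE ltnS => /(rounded_sorted (part c) th_M) le_ii'.
by apply: le_lt_trans lt_q; rewrite q_le.
Qed.

Let cumulated p r :=
  (\sum_(th < M) #|[set c | (part c == p) && (region (rounded y th) c <= r)]|)%N.

Let cumulated_bounds p r : (r <= S)%N ->
  (r.+1 * (M * delta) <= S.+1 * cumulated p r <=
     r.+1 * (M * delta) + S.+1 * (delta * D ^ 2))%N.
Proof.
rewrite leq_eqVlt => /predU1P[->|lt_r].
  suff -> : cumulated p S = (M * delta)%N by rewrite leqnn leq_addr.
  rewrite /cumulated -[M in RHS]card_ord -sum_nat_const; apply: eq_bigr => th _.
  rewrite -(card_part p); congr #|pred_of_set _|; apply/setP => c; rewrite !inE.
  by rewrite -ltnS region_lt andbT.
suff -> : cumulated p r = mass y (p, Ordinal lt_r).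
  by apply/andP; split; [exact: (mass_lower (p, _))|exact: ltnW (mass_upper (p, _))].
apply: eq_bigr => th _; congr #|pred_of_set _|; apply/setP => c; rewrite !inE /=.
by case: eqP => //= <-; rewrite -region_le.
Qed.

(** The mass of a gap is the difference of consecutive cumulated masses, each on target up to the
    Lipschitz error. *)
Lemma region_mass p (r : 'I_S.+1) :
  (S.+1 * \sum_(th < M) #|[set c | (part c == p) && (region (rounded y th) c == r)]|
     <= delta * (M + S.+1 * D ^ 2))%N.
Proof.
case: r => -[|r] lt_r /=; set mu := (\sum_(th < M) _)%N.
  have -> : mu = cumulated p 0.
    apply: eq_bigr => th _; congr #|pred_of_set _|; apply/setP => c.
    by rewrite !inE leqn0.
  by have /andP[_] := cumulated_bounds p (leq0n S); lia.
have e : (mu + cumulated p r)%N = cumulated p r.+1.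
  rewrite -big_split /=; apply: eq_bigr => th _.
  rewrite -cardsUI [X in (_ + X)%N]eq_card0 ?addn0 => [|c]; last first.
    by rewrite !inE; apply/negP; lia.
  congr #|pred_of_set _|; apply/setP => c; rewrite !inE [in RHS]leq_eqVlt ltnS.
  by rewrite -andb_orr.
have le_r : (r.+1 <= S)%N by rewrite -ltnS.
have /andP[_ h1] := cumulated_bounds p le_r.
have /andP[h2 _] := cumulated_bounds p (ltnW le_r).
move: h1; rewrite -e mulnDr; move: h2.
move: (S.+1 * mu)%N (S.+1 * cumulated p r)%N => a b.
nia.
Qed.

Let rounded_chain th th' j : (th <= th' < M)%N ->
  rounded y th j != rounded y th' j ->
  [/\ odd (rounded y th j), ~~ odd (rounded y th' j) &
      rounded y th' j = (rounded y th j).+1 \/ rounded y th j = (rounded y th' j).+1].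
Proof.
move=> /andP[le_th lt_th']; rewrite !ffunE; apply: rnd_chain; rewrite ?le_th //.
exact: leq_ltn_trans lt_th'.
Qed.

Let rounded_col th th' : (th < M)%N -> (th' < M)%N ->
  col (rounded y th) = col (rounded y th') -> rounded y th = rounded y th'.
Proof.
move=> th_M th'_M ecol; apply/eqP; apply: contraT => ne.
wlog le_th : th th' th_M th'_M ecol ne / (th <= th')%N.
  have [/[swap] H|/ltnW/[swap] H] := leqP th th'; first exact: H.
  by apply: H => //; rewrite eq_sym.
have le_th' : (th <= th' < M)%N by rewrite le_th.
by have /eqP[] := col_odd_adjacent ne (fun j => @rounded_chain th th' j le_th').
Qed.

Let rounded_adjacent th th' j : (th < M)%N -> (th' < M)%N ->
  (rounded y th j <= (rounded y th' j).+1)%N /\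
  (rounded y th' j <= (rounded y th j).+1)%N.
Proof.
wlog le_th : th th' / (th <= th')%N.
  have [/[swap] H|/ltnW/[swap] H] := leqP th th'; first exact: H.
  by move=> le_th th_M th'_M; have [] := H th' th le_th th'_M th_M.
move=> th_M th'_M; have [->|ne] := eqVneq (rounded y th j) (rounded y th' j).
  by split.
have [|_ _] := rounded_chain _ ne; first by rewrite le_th.
lia.
Qed.

(** A threshold whose vertex has color [i]. The default serves colors that never occur, whose weight
    will be 0. *)
Let threshold (i : 'I_n) : 'I_M :=
  odflt (Ordinal M_gt0) [pick th : 'I_M | col (rounded y th) == i].

Let thresholdP (th : 'I_M) :
  rounded y (threshold (col (rounded y th))) = rounded y th.
Proof.
rewrite /threshold; case: pickP => [th' /eqP|/(_ th)]; last by rewrite eqxx.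
exact: rounded_col.
Qed.

Lemma colorful_fractional : exists (h : 'I_n -> dint R d) (w : 'I_n -> R)
    (r : 'I_n -> 'I_d -> 'I_S.+1),
  let T i := [set (part c, r i c) | c : 'I_d] in
  [/\ fractional T w, S%:R < delta%:R * \sum_i w i,
      forall i, w i != 0 -> h i \in F i &
      forall i i', [disjoint T i & T i'] ->
        forall x, ~~ (in_dint (h i) x && in_dint (h i') x)].
Proof.
pose cnt i := #|[set th : 'I_M | col (rounded y th) == i]|.
have cntE (p : pred 'I_n) :
    (\sum_(i | p i) cnt i = \sum_(th < M) p (col (rounded y th)))%N.
  under eq_bigr do rewrite /cnt -sum1dep_card.
  rewrite (exchange_big_dep xpredT) //=; apply: eq_bigr => th _.
  rewrite (eq_bigl (fun i => (i == col (rounded y th)) && p i)); last first.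
    by move=> i; rewrite andbC eq_sym.
  by rewrite big_mkcondr big_pred1_eq; case: (p _).
(* By [region_mass] this normalization keeps every load at most 1. A gap counts once in [T], even if
   several components lie in it. *)
pose den := (delta * (M + S.+1 * D ^ 2))%N.
have den_gt0 : (0 < den)%N by rewrite muln_gt0 delta_gt0 addn_gt0 M_gt0.
pose w i : R := (cnt i)%:R * (S.+1%:R / den%:R).
exists (fun i => edge (rounded y (threshold i))), w.
exists (fun i c => Ordinal (region_lt (rounded y (threshold i)) c)) => T.
have sum_w p : \sum_(i | p i) w i = (\sum_(i | p i) cnt i)%N%:R * (S.+1%:R / den%:R).
  by rewrite natr_sum mulr_suml.
split.
- split=> [i|x]; first by rewrite mulr_ge0 // divr_ge0.
  rewrite /load sum_w mulrA ler_pdivrMr ?ltr0n // mul1r -natrM ler_nat mulnC.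
  case: x => p r; apply: leq_trans (region_mass p r); rewrite leq_mul2l /= cntE.
  apply: leq_sum => th _; case: (boolP (_ \in _)) => //= /imsetP[c _ [pc rc]].
  apply/card_gt0P; exists c; rewrite inE -pc eqxx /= rc /=.
  by rewrite thresholdP.
- rewrite sum_w cntE sum1_card card_ord.
  rewrite !mulrA ltr_pdivlMr ?ltr0n // -!natrM ltr_nat /den.
  move: delta_gt0 M_large; nia.
- move=> i; rewrite mulf_eq0 negb_or pnatr_eq0 => /andP[+ _].
  rewrite -lt0n => /card_gt0P[th]; rewrite inE => /eqP <-.
  rewrite thresholdP; exact: edge_col.
- move=> i i' disj; apply: regions_disjoint => // j.
  exact: rounded_adjacent.
Qed.
End Threshold.
End Colourful.

Theorem colorful_fractional_matching (R : realType) (d n P S delta : nat)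
    (F : 'I_n -> seq (dint R d)) (part : 'I_d -> 'I_P) :
  (0 < delta)%N ->
  (forall p, #|[set c | part c == p]| = delta) ->
  (forall i (h : dint R d) c, h \in F i -> (h c).1 <= (h c).2) ->
  (forall i i' (h h' : dint R d) (c c' : 'I_d) x, h \in F i -> h' \in F i' ->
     (h c).1 <= x <= (h c).2 -> (h' c').1 <= x <= (h' c').2 -> part c = part c') ->
  (forall C : seq R, (size C <= P * S)%N ->
     (P * S < #|[set i | has (fun h => ~~ has (in_dint h) C) (F i)]|)%N) ->
  exists (h : 'I_n -> dint R d) (w : 'I_n -> R) (r : 'I_n -> 'I_d -> 'I_S.+1),
  let T i := [set (part c, r i c) | c : 'I_d] in
  [/\ fractional T w, S%:R < delta%:R * \sum_i w i,
      forall i, w i != 0 -> h i \in F i &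
      forall i i', [disjoint T i & T i'] ->
        forall x, ~~ (in_dint (h i) x && in_dint (h i') x)].
Proof.
move=> delta_gt0 card_part F_wf F_part F_good.
pose ends (h : dint R d) := [seq (h c).1 | c : 'I_d] ++ [seq (h c).2 | c : 'I_d].
have [N [q [q_mono q_ends]]] :=
  grid_exists (flatten [seq flatten [seq ends h | h <- F i] | i : 'I_n]).
have q_in i (h : dint R d) x : h \in F i -> x \in ends h ->
    exists2 a, (a < N)%N & x = q a.*2.+1.
  move=> hF xh; have [|a aN ->] := q_ends x; last by exists a.
  apply/flatten_imageP; exists i => //.
  by apply/flatten_mapP; exists h.
have q_left i (h : dint R d) c : h \in F i -> exists2 a, (a < N)%N & (h c).1 = q a.*2.+1.
  by move=> hF; apply: q_in hF _; rewrite mem_cat image_f.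
have q_right i (h : dint R d) c : h \in F i -> exists2 a, (a < N)%N & (h c).2 = q a.*2.+1.
  by move=> hF; apply: q_in hF _; rewrite mem_cat image_f ?orbT.
have cards : (#|{: 'I_P * 'I_S}| = P * S)%N by rewrite card_prod !card_ord.
(* At most [P * S] cuts are odd and more than [P * S] colors are good, so a good color of the
   required rank exists. *)
have /choice[ce ceP] (v : {ffun 'I_P * 'I_S -> nat}) : exists ce : 'I_n * dint R d,
    [/\ ce.2 \in F ce.1, avoids q v ce.2 &
     #|[set z in good F q v | (z < ce.1)%N]| = #|odd_cuts v|].
  have : (#|odd_cuts v| < #|good F q v|)%N.
    have := F_good [seq q (v j) | j : 'I_P * 'I_S].
    rewrite size_map -cardE cards leqnn => /(_ isT) lt_good.
    apply: (leq_ltn_trans (max_card _)); rewrite cards.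
    apply: leq_trans lt_good _; apply: subset_leq_card; apply/subsetP => i.
    rewrite !inE => /hasP[h hF hN]; apply/hasP; exists h => //.
    apply/forallP => j; apply: contra hN => hj; apply/hasP.
    by exists (q (v j)); rewrite // image_f.
  case/ranked_element => c; rewrite inE => /hasP[h hF hv] <-.
  by exists (c, h).
(* Enough thresholds for the rounding error to preserve the order of the cuts and the strict bound
   on the total weight. *)
pose M := (S.+1 ^ 2 * #|{: 'I_P * 'I_S}|.+1 ^ 2)%N.
pose edge v := (ce v).2; pose col v := (ce v).1.
have edge_col v : edge v \in F (col v) by have [] := ceP v.
have edge_avoids v : avoids q v (edge v) by have [] := ceP v.
have col_rank v : #|[set z in good F q v | (z < col v)%N]| = #|odd_cuts v|.
  by have [] := ceP v.
have [||y y_pos y_neg] := @cube_sign_change ('I_P * 'I_S)%type (2 * M * N)%N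
  (@below_target _ d P S delta part N q edge M).
- by move=> j y; apply: (above_target_top delta_gt0 card_part q_mono q_left edge_col).
- by move=> j y; apply: (below_target_bot delta_gt0 card_part q_mono q_left edge_col).
exact: (colorful_fractional delta_gt0 card_part F_wf F_part q_mono q_left q_right
  edge_col edge_avoids col_rank (leqnn M) y_pos y_neg).
Qed.

(** * Colorful matchings *)

(** Otherwise [n - k] colors have all their edges met by [C], which is then too small a cover of
    their union. *)
Lemma many_good_colors (R : realType) d n k (F : 'I_n -> seq (dint R d)) :
  (k < n)%N ->
  (forall I : {set 'I_n}, #|I| = (n - k)%N -> tau_ge (union_fam F I) k.+1) ->
  forall C : seq R, (size C <= k)%N ->
    (k < #|[set i | has (fun h => ~~ has (in_dint h) C) (F i)]|)%N.
Proof.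
move=> lt_kn tauF C le_Ck; set G := [set i | _]; rewrite ltnNge; apply/negP => le_Gk.
pose s := take (n - k) (enum (~: G)).
have us : uniq s by rewrite take_uniq ?enum_uniq.
have size_s : size s = (n - k)%N.
  by rewrite size_takel // -cardE cardsCs setCK card_ord leq_sub2l.
have cI : #|[set i in s]| = (n - k)%N by rewrite cardsE (card_uniqP us).
have := tauF _ cI (undup C) (undup_uniq C) _.
rewrite leqNgt ltnS (leq_trans (size_undup C)) // => H; apply: notF; apply: H.
move=> e /flatten_mapP[i]; rewrite mem_enum inE => /mem_take.
rewrite mem_enum !inE => /hasPn iG /iG; rewrite negbK => /hasP[x xC xe].
by exists x; rewrite ?mem_undup.
Qed.

Lemma colorful_matching_of_disjoint (R : realType) d n (F : 'I_n -> seq (dint R d))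
    (V : finType) (T : 'I_n -> {set V}) (h : 'I_n -> dint R d) (A : {set 'I_n}) :
  {in A, forall i, h i \in F i} ->
  {in A &, forall i j, i != j -> [disjoint T i & T j]} ->
  (forall i i', [disjoint T i & T i'] ->
     forall x, ~~ (in_dint (h i) x && in_dint (h i') x)) ->
  exists M, colorful_matching F M /\ size M = #|A|.
Proof.
move=> hF Tdis hdis; exists [seq (i, h i) | i <- enum A].
split; last by rewrite size_map -cardE.
split; first by rewrite -map_comp map_id enum_uniq.
  by move=> p /mapP[i]; rewrite mem_enum => iA -> /=; apply: hF.
move=> p p' /mapP[i + ->] /mapP[i' + ->]; rewrite !mem_enum /= => iA i'A ii' x.
exact/hdis/Tdis.
Qed.

Lemma large_matching (R : realType) d n k (F : 'I_n -> seq (dint R d)) :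
  (0 < d)%N -> (k < n)%N -> (forall i, all (@dint_wf R d) (F i)) ->
  (forall I : {set 'I_n}, #|I| = (n - k)%N -> tau_ge (union_fam F I) k.+1) ->
  exists M, colorful_matching F M /\ (k < (d ^ 2 - d.-1) * size M)%N.
Proof.
move=> d_gt0 lt_kn wfF tauF.
have F_wf i (h : dint R d) c : h \in F i -> (h c).1 <= (h c).2.
  by move/(allP (wfF i))/forallP.
have [|||h [w [r [fw sumw hF hdis]]]] :=
  @colorful_fractional_matching R d n 1 k d F (fun=> ord0) d_gt0 _ F_wf.
- by move=> p; rewrite -[RHS]card_ord; apply: eq_card => c; rewrite inE (ord1 p).
- by [].
- by rewrite mul1n; apply: many_good_colors.
set T := fun i : 'I_n => _ in fw hdis.
have T_neq0 i : T i != set0.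
  by apply/set0Pn; exists (ord0, r i (Ordinal d_gt0)); apply: imset_f.
have T_d i : (#|T i| <= d)%N by rewrite -[leqRHS]card_ord leq_imset_card.
have [|A [As Adis le_w]] := greedy_matching T_neq0 T_d (rho := d) _ fw.
  by move=> w' fw' bw' w'_neq0; apply: heavy_edge fw' bw' w'_neq0 T_d.
have := lt_le_trans sumw le_w; rewrite -natrM ltr_nat mulnn => lt_k.
have hFA : {in A, forall i, h i \in F i}.
  by move=> i /(subsetP As); rewrite inE; apply: hF.
have [M [colM sizeM]] := colorful_matching_of_disjoint hFA Adis hdis.
by exists M; rewrite sizeM.
Qed.

Lemma large_separated_matching (R : realType) d n m (F : 'I_n -> seq (dint R d)) :
  (1 < d)%N -> (d * m < n)%N -> (forall i, all (@dint_sep R d) (F i)) ->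
  (forall I : {set 'I_n}, #|I| = (n - d * m)%N -> tau_ge (union_fam F I) (d * m).+1) ->
  exists M, colorful_matching F M /\ (m < d.-1 * size M)%N.
Proof.
move=> d_gt1 lt_n sepF tauF.
have F_sep i (h : dint R d) c : h \in F i ->
    [&& (h c).1 <= (h c).2, c%:R < (h c).1 & (h c).2 < c%:R + 1].
  by move/(allP (sepF i))/forallP.
have [|||||h [w [r [fw sumw hF hdis]]]] :=
  @colorful_fractional_matching R d n d m 1 F id.
- by [].
- by move=> p; rewrite -(cards1 p); congr #|pred_of_set _|; apply/setP => c; rewrite !inE.
- by move=> i h c /(F_sep _ _ c)/and3P[].
- move=> i i' h h' c c' x hF hF' /andP[x1 x2] /andP[x1' x2'].
  (* Components sharing a point lie in the same unit interval, so they have the same index. *)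
  have lt_sep (a b : 'I_d) (g g' : dint R d) i1 i2 : g \in F i1 -> g' \in F i2 ->
      x <= (g a).2 -> (g' b).1 <= x -> (b <= a)%N.
    move=> /(F_sep _ _ a)/and3P[_ _ ga] /(F_sep _ _ b)/and3P[_ gb _] xa xb.
    rewrite -ltnS -(ltr_nat R) -natr1.
    exact: lt_le_trans gb (le_trans xb (le_trans xa (ltW ga))).
  apply/ord_inj/eqP; rewrite eqn_leq.
  by rewrite (lt_sep c' c h' h i' i) // (lt_sep c c' h h' i i').
- exact: many_good_colors.
set T := fun i : 'I_n => _ in fw hdis.
have T_neq0 i : T i != set0.
  have d_gt0 := ltnW d_gt1.
  by apply/set0Pn; exists (Ordinal d_gt0, r i (Ordinal d_gt0)); apply: imset_f.
have T_d i : (#|T i| <= d)%N by rewrite -[leqRHS]card_ord leq_imset_card.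
have T_part i (c : 'I_d) : #|[set v in T i | v.1 == c]| = 1%N.
  rewrite -(cards1 (c, r i c)); congr #|pred_of_set _|; apply/setP => v.
  rewrite !inE; apply/andP/eqP => [[/imsetP[c' _ ->] /= /eqP -> //]|-> /=].
  by rewrite imset_f.
have [|A [As Adis le_w]] := greedy_matching T_neq0 T_d (rho := d.-1) _ fw.
  move=> w' fw' bw' w'_neq0.
  have c01 : Ordinal (ltnW d_gt1) != Ordinal d_gt1 by [].
  exact: (heavy_edge_partite T_neq0 c01 T_d T_part fw' bw' w'_neq0).
(* The greedy constant is a square here, and one factor [d.-1] cancels. *)
move: le_w; have -> : (d * d.-1 - d.-1 = d.-1 * d.-1)%N by rewrite -!subn1 mulnBl mul1n.
rewrite natrM -mulrA ler_pM2l; last by rewrite ltr0n -subn1 subn_gt0.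
rewrite mul1r in sumw.
move=> /(lt_le_trans sumw); rewrite -natrM ltr_nat => lt_m.
have hFA : {in A, forall i, h i \in F i}.
  by move=> i /(subsetP As); rewrite inE; apply: hF.
have [M [colM sizeM]] := colorful_matching_of_disjoint hFA Adis hdis.
by exists M; rewrite sizeM.
Qed.

Theorem theorem1p8 (R : realType) (d : nat) : (0 < d)%N ->
  (forall (n k : nat) (F : 'I_n -> seq (dint R d)),
     (0 < n)%N -> (0 < k)%N -> (k <= n)%N ->
     (forall i, all (@dint_wf R d) (F i)) ->
     (forall I : {set 'I_n}, #|I| = (n - k + 1)%N -> tau_ge (union_fam F I) k) ->
     exists M, colorful_matching F M /\
       (k%:R / (d ^ 2 - d + 1)%N%:R : R) <= (size M)%:R)
  /\
  (forall (n m : nat) (F : 'I_n -> seq (dint R d)),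
     (1 < d)%N -> (0 < n)%N -> (0 < m)%N -> ((m - 1) * d + 1 <= n)%N ->
     (forall i, all (@dint_sep R d) (F i)) ->
     (forall I : {set 'I_n}, #|I| = (n - (m - 1) * d)%N ->
        tau_ge (union_fam F I) ((m - 1) * d + 1)) ->
     exists M, colorful_matching F M /\
       (m%:R / (d - 1)%N%:R : R) <= (size M)%:R).
Proof.
(* [k] and [m] are replaced by their predecessors, so the strict integer bounds of the two lemmas
   give the claimed ones. *)
move=> d_gt0; split=> [n [//|k] F _ _ le_kn wfF tauF|n [//|m] F d_gt1 _ _ le_n sepF tauF].
  have [I cI|M [colM lt_k]] := large_matching d_gt0 le_kn wfF.
    by apply: tauF; rewrite cI; lia.
  exists M; split=> //; rewrite ler_pdivrMr ?ltr0n ?addn1 // -natrM ler_nat mulnC.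
  by have <- : (d ^ 2 - d.-1 = (d ^ 2 - d).+1)%N by rewrite -mulnn; nia.
rewrite subn1 /= addn1 mulnC in le_n tauF.
have [M [colM lt_m]] := large_separated_matching d_gt1 le_n sepF tauF.
exists M; split=> //; rewrite subn1 ler_pdivrMr ?ltr0n; last by lia.
by rewrite -natrM ler_nat mulnC.
Qed.
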